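(* Let $k\ge2$ and let $P_\pi$ be a weighted poset on the set of coordinate positions $\{1,\dots,2^k\}$, with induced digraph $G_\pi$ and associated map $\varphi_\pi$. If the extended Hamming code $\widetilde{\mathcal H}_k$ is a packing $P_\pi$-code of packing radius $2$, then $\widetilde{\mathcal H}_k^{\varphi_\pi}=\{c^{\varphi_\pi}:c\in\widetilde{\mathcal H}_k\}$ is a packing $G_\pi$-code with packing radius $2$.
   Context: Binary vectors are identified with their supports. A weighted poset $P_\pi$ is a finite poset $(P,\preceq)$ with a function $\pi:P\to\{1,2,3,\dots\}$. Coordinates of $\mathbb{F}_2^{m}$, $m=|P|$, are labelled by $P$. $\langle x\rangle_P$ is the smallest order ideal (down-closed subset) containing the support of $x$; $w_{P_\pi}(x)=\sum_{i\in\langle x\rangle_P}\pi(i)$, $d_{P_\pi}(x,y)=w_{P_\pi}(x-y)$. A digraph $G$ is a finite directed graph without loops or multiple edges. Coordinates of $\mathbb{F}_2^n$, $n=|V(G)|$, are labelled by $V(G)$. $\langle x\rangle_G$ is the support of $x$ together with all vertices reachable by a directed path from it; $w_G(x)=|\langle x\rangle_G|$, $d_G(x,y)=w_G(x-y)$. For $*$ a weighted poset or a digraph, $S_*(x;r)=\{y:d_*(x,y)\le r\}$. A code $C$ is an $r$-packing $*$-code if the spheres $S_*(c;r)$, $c\in C$, are pairwise disjoint. The packing radius of $C$ is the largest integer $r$ such that $C$ is an $r$-packing $*$-code. Induced digraph: for $a\in P$ let $\hat a=\{a_0,a_1,\dots,a_{\pi(a)-1}\}$ with $a_0=a$ (disjoint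 for different $a$). $G_\pi$ has vertex set $\bigcup_a\hat a$, of size $n=\sum_a\pi(a)$, and edges $(a,b)$ for $b\preceq a$, $b\ne a$ in $P$, together with $(a_i,a_{i+1})$, subscripts modulo $\pi(a)$, for every $a$ with $\pi(a)\ge2$. For $u\in\mathbb{F}_2^m$, $u^{\varphi_\pi}\in\mathbb{F}_2^n$ is the vector with value $u_a$ at $a_0$ for each $a\in P$, and $0$ at all other vertices. $\widetilde{\mathcal H}_k\subseteq\mathbb{F}_2^{2^k}$ is the extended Hamming code: the null space of the $(k+1)\times2^k$ binary matrix whose first row is all ones and whose remaining $k$ rows form the matrix whose $i$-th column is the binary representation of $i-1$. *)

(* Defs.v *)
From HB Require Import structures.
From mathcomp Require Import all_boot all_order all_algebra.

Set Implicit Arguments.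
Unset Strict Implicit.
Unset Printing Implicit Defensive.

Import GRing.Theory.
Local Open Scope ring_scope.

(* Binary vectors with coordinates labelled by T. *)
Notation bvec T := {ffun T -> 'F_2}.

Definition supp (T : finType) (x : bvec T) : {set T} := [set i | x i != 0].

Section Packing.
Variables (T : finType) (w : bvec T -> nat).

Definition dist (x y : bvec T) : nat := w (x - y).

Definition sphere (x : bvec T) (r : nat) : {set bvec T} :=
  [set y | (dist x y <= r)%N].

Definition packing (C : {set bvec T}) (r : nat) : Prop :=
  {in C &, forall c c', c != c' -> [disjoint sphere c r & sphere c' r]}.

(* Every code is a 0-packing when w is nonzero off 0, so ranging over natural
   numbers instead of integers does not change the largest radius. *)
Definition has_packing_radius (C : {set bvec T}) (r : nat) : Prop :=
  packing C r /\ forall s, packing C s -> (s <= r)%N.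

End Packing.

(* The order is carried by the record since T itself may be a type, such as
   'I_n, with a canonical order unrelated to the one considered. *)
Record weighted_poset (T : finType) := WeightedPoset {
  wp_le : rel T;
  wp_refl : reflexive wp_le;
  wp_anti : antisymmetric wp_le;
  wp_trans : transitive wp_le;
  wp_wt : T -> nat;
  wp_wt_gt0 : forall a, (0 < wp_wt a)%N
}.

Section PosetMetric.
Variables (T : finType) (P : weighted_poset T).

Definition order_ideal (I : {set T}) : bool :=
  [forall a in I, forall b, wp_le P b a ==> (b \in I)].

Definition poset_span (x : bvec T) : {set T} :=
  \bigcap_(I : {set T} | order_ideal I && (supp x \subset I)) I.

Definition poset_weight (x : bvec T) : nat :=
  (\sum_(i in poset_span x) wp_wt P i)%N.

End PosetMetric.

Record digraph (V : finType) := Digraph {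
  edge : rel V;
  edge_irr : irreflexive edge
}.

Section DigraphMetric.
Variables (V : finType) (G : digraph V).

(* connect is reflexive, so this contains supp x. *)
Definition digraph_span (x : bvec V) : {set V} :=
  [set v | [exists u in supp x, connect (edge G) u v]].

Definition digraph_weight (x : bvec V) : nat := #|digraph_span x|.

End DigraphMetric.

Section InducedDigraph.
Variables (T : finType) (P : weighted_poset T).

(* The vertex a_i is Tagged _ i, with tag a : T and i : 'I_(wp_wt P a). *)
Definition ivertex : finType := {a : T & 'I_(wp_wt P a)}.

Definition vidx (v : ivertex) : nat := tagged v.

Definition iedge : rel ivertex := fun u v =>
  [&& vidx u == 0%N, vidx v == 0%N,
      wp_le P (tag v) (tag u) & tag v != tag u]
  || [&& tag u == tag v, (2 <= wp_wt P (tag u))%N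
       & vidx v == ((vidx u).+1 %% wp_wt P (tag u))%N].

Lemma iedge_irr : irreflexive iedge.
Proof.
case=> a i; rewrite /iedge /vidx /= eqxx /= !andbF /=.
apply/negP => /andP[pi2 /eqP ei].
have := ltn_ord i; rewrite leq_eqVlt => /orP[/eqP e|lt].
  by move: pi2; rewrite -e ei e modnn.
by move: ei; rewrite modn_small // => /n_Sn.
Qed.

Definition induced_digraph : digraph ivertex := Digraph iedge_irr.

Definition phi (u : bvec T) : bvec ivertex :=
  [ffun v => if vidx v == 0%N then u (tag v) else 0].

End InducedDigraph.

Section ExtendedHamming.
Variable k : nat.

(* Column j, counted from 0, is the binary representation of j, most
   significant bit in the top row. *)
Definition binary_mx : 'M['F_2]_(k, 2 ^ k) :=
  \matrix_(i, j) (odd (j %/ 2 ^ (k - i.+1)))%:R.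

Definition ext_hamming_mx : 'M['F_2]_(1 + k, 2 ^ k) :=
  col_mx (const_mx 1) binary_mx.

Definition ext_hamming : {set bvec 'I_(2 ^ k)} :=
  [set x : bvec 'I_(2 ^ k) | ext_hamming_mx *m (\col_j x j) == 0].

End ExtendedHamming.

(* Main.v *)
Require Import Defs.
From mathcomp Require Import all_boot all_order all_algebra.

(** The map phi is an isometry from the poset metric to the metric of the
    induced digraph: the vertices reached from the support of [phi P u] are
    exactly the whole cycles over the order ideal spanned by [u], and the cycle
    over [a] has as many vertices as the weight of [a] ([digraph_weight_phi]).
    Hence a packing of the image code of any radius is a packing of the
    original code, so the packing radius cannot grow.

    The digraph space has more points than the image of phi, and the content of
    the theorem is that none of them is a new obstruction to a 2-packing.
    Suppose [y] lies within distance 2 of [phi P c] and of [phi P c'], with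
    distinct codewords [c], [c'].  A vector of digraph weight at most 2 has at
    most 2 nonzero coordinates, so the two differences [phi P c - y] and
    [phi P c' - y] have at most 4 nonzero coordinates in total; but the support
    of [phi P (c - c')] lies in the union of their supports and has at least 4
    elements, the minimum distance of the extended Hamming code
    ([ext_hamming_min_dist]).  So the union equals that support, which consists
    of base vertices a_0; then [y] vanishes off the base vertices, that is, [y]
    is in the image of phi, and the isometry yields a common point of the
    spheres around [c] and [c'] in the poset metric. *)

Set Implicit Arguments.
Unset Strict Implicit.
Unset Printing Implicit Defensive.

Import GRing.Theory.
Local Open Scope ring_scope.

Lemma packingP (T : finType) (w : bvec T -> nat) (C : {set bvec T}) (r : nat) :
  packing w C r <->
  {in C &, forall c c' y,
     (dist w c y <= r)%N -> (dist w c' y <= r)%N -> c = c'}.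
Proof.
split=> pk c c' cC c'C.
  move=> y yc yc'; apply/eqP; apply: contraT => ne.
  by have /pred0P/(_ y) := pk c c' cC c'C ne; rewrite /= !inE yc yc'.
move=> ne; apply/pred0P => y /=; rewrite !inE; apply: contraNF ne.
by case/andP=> yc yc'; rewrite (pk c c' cC c'C y).
Qed.

Lemma suppB (T : finType) (x y : bvec T) :
  supp (x - y) \subset supp x :|: supp y.
Proof.
apply/subsetP=> i; rewrite !inE !ffunE -negb_and; apply: contra.
by case/andP=> /eqP-> /eqP->; rewrite subr0.
Qed.

Lemma card_supp_le_digraph_weight (V : finType) (G : digraph V) (x : bvec V) :
  (#|supp x| <= digraph_weight G x)%N.
Proof.
apply/subset_leq_card/subsetP=> v xv; rewrite inE.
by apply/existsP; exists v; rewrite xv connect0.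
Qed.

(** * Minimum distance of the extended Hamming code *)

Lemma F2_neq0 (x : 'F_2) : x != 0 -> x = 1.
Proof. by case: x => [[|[|n]] lt] // _; apply: val_inj. Qed.

Lemma F2_natr_eq0 (n : nat) : ((n%:R : 'F_2) == 0) = ~~ odd n.
Proof. by rewrite -(dvdn_pcharf (pchar_Fp (isT : prime 2))) dvdn2. Qed.

Lemma F2_sum_supp (T : finType) (x : bvec T) (F : T -> 'F_2) :
  \sum_i F i * x i = \sum_(i in supp x) F i.
Proof.
rewrite (bigID (mem (supp x))) /= [X in _ + X]big1 ?addr0 => [|i]; last first.
  by rewrite inE negbK => /eqP->; rewrite mulr0.
by apply: eq_bigr => i; rewrite inE => /F2_neq0->; rewrite mulr1.
Qed.

Lemma eq_from_bits (k a b : nat) :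
  (a < 2 ^ k)%N -> (b < 2 ^ k)%N ->
  (forall t, (t < k)%N -> odd (a %/ 2 ^ t) = odd (b %/ 2 ^ t)) -> a = b.
Proof.
elim: k a b => [|k IHk] a b; first by case: a b => [|?] [|?].
move=> lta ltb eqb; have := eqb 0 isT; rewrite !divn1 => eq_odd.
suff eq_half : (a %/ 2 = b %/ 2)%N.
  by rewrite -(odd_double_half a) -(odd_double_half b) eq_odd -!divn2 eq_half.
apply: IHk => [||t ltk]; rewrite ?ltn_divLR -?expnSr //.
by rewrite -!divnMA -expnS eqb.
Qed.

Lemma ext_hammingB (k : nat) (c c' : bvec 'I_(2 ^ k)) :
  c \in ext_hamming k -> c' \in ext_hamming k -> c - c' \in ext_hamming k.
Proof.
rewrite !inE => /eqP Hc /eqP Hc'.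
have -> : \col_j (c - c') j = \col_j c j - \col_j c' j.
  by apply/colP=> j; rewrite !mxE !ffunE.
by rewrite mulmxBr Hc Hc' subr0.
Qed.

Lemma ext_hamming_parity (k : nat) (c : bvec 'I_(2 ^ k)) :
  c \in ext_hamming k -> ~~ odd #|supp c|.
Proof.
rewrite inE mul_col_mx col_mx_eq0 => /andP[/eqP/matrixP/(_ 0 0) + _].
rewrite !mxE => sum0.
rewrite -F2_natr_eq0 -sumr_const -F2_sum_supp -[X in _ == X]sum0.
by apply/eqP/eq_bigr=> i _; rewrite !mxE.
Qed.

Lemma ext_hamming_bit_sum (k : nat) (c : bvec 'I_(2 ^ k)) (t : nat) :
  c \in ext_hamming k -> (t < k)%N ->
  \sum_(j in supp c) (odd (j %/ 2 ^ t))%:R = 0 :> 'F_2.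
Proof.
rewrite inE mul_col_mx col_mx_eq0 => /andP[_ /eqP/matrixP syn0] ltk.
(* The rows list the most significant bit first, so bit t sits in row k-1-t. *)
have := syn0 (rev_ord (Ordinal ltk)) 0; rewrite !mxE => sum0.
rewrite -F2_sum_supp -[RHS]sum0; apply: eq_bigr => j _; rewrite !mxE /=.
by rewrite subnSK // subKn // ltnW.
Qed.

(** The parity row excludes odd weights; weight 2 is excluded since the columns
    of the binary rows are pairwise distinct. *)
Lemma ext_hamming_min_dist (k : nat) (c c' : bvec 'I_(2 ^ k)) :
  c \in ext_hamming k -> c' \in ext_hamming k -> c != c' ->
  (4 <= #|supp (c - c')%R|)%N.
Proof.
move=> cC c'C ne; have := ext_hammingB cC c'C.
have : c - c' != 0 by rewrite subr_eq0.
move: (c - c') => d d_neq0 dC; have := ext_hamming_parity dC.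
case E: #|supp d| => [|[|[|[|n]]]] // _.
  case/negP: d_neq0; apply/eqP/ffunP=> i; rewrite ffunE.
  by have /setP/(_ i) := cards0_eq E; rewrite !inE => /negbFE/eqP.
have /cards2P[i [j [ne_ij supp_d]]] : #|supp d| == 2 by rewrite E.
case/eqP: (ne_ij); apply/ord_inj/(@eq_from_bits k) => // t ltk.
have := ext_hamming_bit_sum dC ltk; rewrite supp_d big_setU1 ?big_set1 ?inE //=.
by move/eqP; rewrite -natrD F2_natr_eq0 oddD !oddb negb_add => /eqP.
Qed.

(** * The embedding into the induced digraph is an isometry *)

(** The elements below the support form an order ideal, by transitivity, and
    every order ideal containing the support contains them. *)
Lemma mem_poset_span (T : finType) (P : weighted_poset T) (x : bvec T) (b : T) :
  (b \in poset_span P x) = [exists a in supp x, wp_le P b a].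
Proof.
apply/bigcapP/idP=> [|/exists_inP[a xa le_ba] I /andP[idI sxI]]; last first.
  have /forall_inP/(_ a (subsetP sxI a xa))/forallP/(_ b) := idI.
  by rewrite le_ba.
pose D := [set b | [exists a in supp x, wp_le P b a]].
move/(_ D); rewrite inE; apply; apply/andP; split.
  apply/forall_inP=> a; rewrite inE => /exists_inP[u xu le_au].
  apply/forallP=> d; apply/implyP=> le_da; rewrite inE.
  by apply/exists_inP; exists u => //; apply: wp_trans le_au.
by apply/subsetP=> a xa; rewrite inE; apply/exists_inP; exists a; rewrite ?wp_refl.
Qed.

Section Isometry.
Variables (T : finType) (P : weighted_poset T).

Definition base_vertex (a : T) : ivertex P :=
  Tagged (fun a => 'I_(wp_wt P a)) (Ordinal (wp_wt_gt0 P a)).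

Lemma phiB (u v : bvec T) : phi P (u - v) = phi P u - phi P v.
Proof. by apply/ffunP=> x; rewrite !ffunE; case: ifP; rewrite ?ffunE ?subrr. Qed.

Lemma phi_base (u : bvec T) (a : T) : phi P u (base_vertex a) = u a.
Proof. by rewrite ffunE. Qed.

Lemma phi_inj : injective (phi P).
Proof. by move=> u v eq_phi; apply/ffunP=> a; rewrite -!phi_base eq_phi. Qed.

Lemma card_supp_phi (u : bvec T) : (#|supp u| <= #|supp (phi P u)|)%N.
Proof.
have base_inj : injective base_vertex by move=> a b /(congr1 tag).
rewrite -(card_imset _ base_inj); apply/subset_leq_card/subsetP=> _ /imsetP[a ua ->].
by move: ua; rewrite !inE phi_base.
Qed.

Lemma ivertex_base (v : ivertex P) : vidx v = 0%N -> v = base_vertex (tag v).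
Proof.
by case: v => a i; rewrite /vidx /= => i0; congr existT; apply: val_inj.
Qed.

Lemma phi_off_base (y : bvec (ivertex P)) :
  (forall v, vidx v != 0%N -> y v = 0) ->
  y = phi P [ffun a => y (base_vertex a)].
Proof.
move=> y0; apply/ffunP=> v; rewrite !ffunE.
by case: eqP => [/ivertex_base{1}->|/eqP/y0].
Qed.

Lemma connect_iedge_le (u v : ivertex P) :
  connect (@iedge T P) u v -> wp_le P (tag v) (tag u).
Proof.
case/connectP=> p; elim: p u => [|w p IHp] u /=; first by move=> _ ->; apply: wp_refl.
case/andP=> uw wp /(IHp w wp) le_vw; apply: wp_trans le_vw _.
by case/orP: uw => [/and4P[] //|/and3P[/eqP-> _ _]]; apply: wp_refl.
Qed.

Lemma connect_base_cycle (v : ivertex P) :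
  connect (@iedge T P) (base_vertex (tag v)) v.
Proof.
case: v => a [i lt_i] /=; elim: i lt_i => [|i IHi] lt_i.
  by rewrite [existT _ _ _]ivertex_base // connect0.
apply: connect_trans (IHi (ltnW lt_i)) (connect1 _).
rewrite /iedge /vidx /= eqxx modn_small // eqxx andbT; apply/orP; right.
by apply: leq_trans lt_i.
Qed.

(** A comparison in P gives an edge between base vertices, and the cycle then
    carries it to every vertex over the smaller element. *)
Lemma connect_base (a : T) (v : ivertex P) :
  connect (@iedge T P) (base_vertex a) v = wp_le P (tag v) a.
Proof.
apply/idP/idP=> [/connect_iedge_le //|le_va].
case: (eqVneq (tag v) a) => [<-|ne]; first exact: connect_base_cycle.
apply: connect_trans (connect1 _) (connect_base_cycle v).
by rewrite /iedge /vidx /= le_va ne.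
Qed.

Lemma mem_digraph_span_phi (u : bvec T) (v : ivertex P) :
  (v \in digraph_span (induced_digraph P) (phi P u))
    = (tag v \in poset_span P u).
Proof.
rewrite inE mem_poset_span; apply/exists_inP/exists_inP=> -[].
  move=> w; rewrite inE ffunE; case: ifP => [/eqP/ivertex_base w0 uw|]; last first.
    by rewrite eqxx.
  by rewrite w0 connect_base => le_vw; exists (tag w); rewrite ?inE.
move=> a ua le_va; exists (base_vertex a); last by rewrite connect_base.
by move: ua; rewrite !inE phi_base.
Qed.

Lemma digraph_weight_phi (u : bvec T) :
  digraph_weight (induced_digraph P) (phi P u) = poset_weight P u.
Proof.
rewrite /digraph_weight /poset_weight -sum1_card.
rewrite (eq_bigl _ _ (mem_digraph_span_phi u)).
under [RHS]eq_bigr => a _ do rewrite -[wp_wt P a]card_ord -sum1_card.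
by rewrite sig_big_dep; apply: eq_bigl => v; rewrite andbT.
Qed.

Lemma dist_phi (u v : bvec T) :
  dist (digraph_weight (induced_digraph P)) (phi P u) (phi P v)
    = dist (poset_weight P) u v.
Proof. by rewrite /dist -phiB digraph_weight_phi. Qed.

(** * Packings and the embedding *)

Lemma packing_of_phi (C : {set bvec T}) (r : nat) :
  packing (digraph_weight (induced_digraph P)) [set phi P c | c in C] r ->
  packing (poset_weight P) C r.
Proof.
move=> /packingP pk; apply/packingP=> c c' cC c'C y; rewrite -!dist_phi => yc yc'.
exact/phi_inj/(pk _ _ (imset_f _ cC) (imset_f _ c'C) _ yc yc').
Qed.

(** When distinct codewords are at Hamming distance at least 2r, two spheres of
    radius r around their images can only meet inside the image of phi: the
    supports of the differences are then forced to fill the support of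
    [phi P (c - c')]. *)
Lemma packing_phi (C : {set bvec T}) (r : nat) :
  {in C &, forall c c', c != c' -> (r + r <= #|supp (c - c')%R|)%N} ->
  packing (poset_weight P) C r ->
  packing (digraph_weight (induced_digraph P)) [set phi P c | c in C] r.
Proof.
move=> minC /packingP pk.
apply/packingP=> _ _ /imsetP[c cC ->] /imsetP[c' c'C ->] y yc yc'.
case: (eqVneq c c') => [-> //|ne]; congr (phi P).
set x := phi P c - y; set z := phi P c' - y.
have xz : x - z = phi P (c - c') by rewrite phiB opprB addrA subrK.
have sub : supp (phi P (c - c')) \subset supp x :|: supp z by rewrite -xz suppB.
have eqU : supp (phi P (c - c')) = supp x :|: supp z.
  apply/eqP; rewrite eqEcard sub /=.
  apply: leq_trans (card_supp_phi _); apply: leq_trans (minC _ _ cC c'C ne).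
  rewrite (leq_trans (leq_card_setU _ _)) // leq_add //.
    exact: leq_trans (card_supp_le_digraph_weight _ _) yc.
  exact: leq_trans (card_supp_le_digraph_weight _ _) yc'.
have /phi_off_base y_phi v : vidx v != 0%N -> y v = 0.
  move=> v0; have : v \notin supp x :|: supp z.
    by rewrite -eqU inE ffunE (negPf v0) eqxx.
  rewrite !inE negb_or !negbK => /andP[+ _].
  by rewrite !ffunE (negPf v0) sub0r oppr_eq0 => /eqP.
by move: yc yc'; rewrite y_phi !dist_phi; apply: pk.
Qed.

End Isometry.

Theorem theorem3p9 (k : nat) (hk : (2 <= k)%N)
  (P : weighted_poset 'I_(2 ^ k)) :
  has_packing_radius (poset_weight P) (ext_hamming k) 2 ->
  has_packing_radius (digraph_weight (induced_digraph P))
    [set phi P c | c in ext_hamming k] 2.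
Proof.
move=> [pk2 max2]; split=> [|s /packing_of_phi/max2 //].
by apply: packing_phi pk2 => c c'; apply: ext_hamming_min_dist.
Qed.
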